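(* Let $G_1$ and $G_2$ be two finitely generated nilpotent groups. If $G_1$ and $G_2$ are commensurable, then $\mathrm{RF}_{G_1} \approx \mathrm{RF}_{G_2}$.
   Context: Two groups $G_1,G_2$ are commensurable if there exist finite index subgroups $H_1\le G_1$ and $H_2\le G_2$ with $H_1\cong H_2$. Let $G$ be a finitely generated residually finite group (finitely generated nilpotent groups are residually finite) with finite generating set $S$. The word norm is $\|g\|_{G,S} = \min\{k\ge 0 \mid g = s_1\cdots s_k,\ s_i\in S\cup S^{-1}\}$. For $g\in G\setminus\{e\}$ put $D_G(g) = \min\{[G:N] \mid N\lhd G,\ g\notin N\}$. The residual finiteness growth is $\mathrm{RF}_{G,S}(r) = \max\{D_G(g)\mid 0<\|g\|_{G,S}\le r\}$ for real $r\ge 1$, with the convention $\max\emptyset = 1$. For non-decreasing functions $f,g$ on $[1,\infty)$ with values in $[0,\infty]$, write $f\preceq g$ if there exists $C>0$ such that $f(r)\le C g(Cr)$ for all $r\ge \max\{1,1/C\}$, and $f\approx g$ if $f\preceq g$ and $g\preceq f$. Up to $\approx$, $\mathrm{RF}_{G,S}$ does not depend on $S$ and is denoted $\mathrm{RF}_G$. *)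

(* Defs.v *)
From mathcomp Require Import all_boot all_order all_algebra.
From mathcomp Require Import all_classical all_reals all_analysis.

Set Implicit Arguments.
Unset Strict Implicit.
Unset Printing Implicit Defensive.

Import Order.TTheory GRing.Theory Num.Theory.

Local Open Scope classical_set_scope.
Local Open Scope group_scope.

Section Groups.
Context {G : groupType}.

Definition subgroup (H : set G) : Prop :=
  H 1 /\ (forall x y, H x -> H y -> H (x / y)).

Definition normal_subgroup (N : set G) : Prop :=
  subgroup N /\ (forall x g, N x -> N (x ^ g)).

Definition generated (A : set G) : set G := smallest subgroup A.

Definition finite_generating_set (S : set G) : Prop :=
  finite_set S /\ generated S = setT.

Definition left_cosets (H : set G) : set (set G) :=
  range (fun g : G => [set g * h | h in H]).

Definition finite_index (H : set G) : Prop := finite_set (left_cosets H).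

(* The index [G : H], equal to +oo when there are infinitely many cosets. *)
Definition subgroup_index (R : realType) (H : set G) : \bar R :=
  counting (left_cosets H).

End Groups.

Section Nilpotent.
Variable G : groupType.

Fixpoint lower_central_series (n : nat) : set G :=
  if n is m.+1 then
    generated [set z | exists x y, lower_central_series m x /\ z = [~ x, y]]
  else setT.

Definition nilpotent_group : Prop :=
  exists n, lower_central_series n = [set 1].

End Nilpotent.

Definition isomorphic_subgroups (G1 G2 : groupType)
    (H1 : set G1) (H2 : set G2) : Prop :=
  exists f : G1 -> G2, set_bij H1 H2 f /\
    (forall x y, H1 x -> H1 y -> f (x * y) = f x * f y).

Definition commensurable (G1 G2 : groupType) : Prop :=
  exists (H1 : set G1) (H2 : set G2),
    [/\ subgroup H1, finite_index H1, subgroup H2, finite_index H2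
      & isomorphic_subgroups H1 H2].

(* Minima and maxima are written as infima and suprema in the extended reals.
   A nonempty set of natural numbers attains its infimum, and the infimum of
   the empty set is +oo.  When S is finite, a ball of the word norm is finite,
   so the supremum defining rf_growth is attained. *)
Section ResidualFinitenessGrowth.
Variables (R : realType) (G : groupType).

Definition word_norm (S : set G) (g : G) : \bar R :=
  ereal_inf [set ((size w)%:R)%:E | w in
    [set w : seq G | (forall s, s \in w -> S s \/ S s^-1) /\
                     g = \prod_(s <- w) s]].

Definition divisibility (g : G) : \bar R :=
  ereal_inf [set subgroup_index R N | N in
    [set N : set G | normal_subgroup N /\ ~ N g]].

Definition rf_growth (S : set G) (r : R) : \bar R :=
  let D := [set divisibility g | g in
             [set g : G | (0 < word_norm S g)%E /\ (word_norm S g <= r%:E)%E]] in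
  if `[< D = set0 >] then 1%E else ereal_sup D.

End ResidualFinitenessGrowth.

Section Growth.
Variable R : realType.
Implicit Types f g : R -> \bar R.
Local Open Scope ring_scope.

Definition growth_le f g : Prop :=
  exists2 C : R, 0 < C &
    forall r : R, Num.max 1 (1 / C) <= r -> (f r <= C%:E * g (C * r)%R)%E.

Definition growth_equiv f g : Prop := growth_le f g /\ growth_le g f.

End Growth.

(* Main.v *)
Require Import Defs.
From HB Require Import structures.
From mathcomp Require Import all_boot all_order all_algebra finmap zify.
From mathcomp Require Import all_classical all_reals all_analysis.

(** Let [H] be a finite index subgroup of a finitely generated nilpotent group
    [G1], and [f] an embedding of [H] into a finitely generated group [G2]. It
    suffices to bound the growth of [G1] by that of [G2]: commensurability gives
    such embeddings in both directions.

    A normal subgroup [N2] of [G2] pulls back to a subgroup [N] of [H] which is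
    normalised by [H], but not by [G1]. Passing to the core of [N] in [G1] would
    raise the index to a power, so the proof passes to the normal closure [M] of
    [N] instead: its index in [G1] is at most [G1 : H] times the index of [N2].
    The danger is that [M] contains the element to be detected. Nilpotency
    limits this: there is an exponent [m], depending only on [G1] and [H], such
    that [x ^+ m] lies in [N] for all [x] in [M] (normal_closure_root). Hence,
    if [N2] misses the image of a suitable fixed power [g ^+ e], then [M]
    misses [g], and D(g) <= [G1 : H] D(f (g ^+ e)) (divisibility_expg_le). The
    word norm of [f (g ^+ e)] is linearly bounded by that of [g], because a
    finite index subgroup is undistorted (partial_morph_lipschitz).

    The exponent [m] comes from two inductions. Up the upper central series of
    [G1] modulo the core of [N], every element of [N] has a bounded power in the
    core (expg_core_exponent): the [k]-th powers of [G1] lie in [H] and so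
    normalise [N], and modulo the next central term [[x, g]^k] is both
    [[x, g^k]] and [[x^k, g]]. Next, the nilpotent group [M] modulo the core is
    generated by elements of bounded order, and therefore has bounded exponent
    (expg_upper_central_modulo).

    The comparison says nothing when [g ^+ e = 1]. All such [g <> 1] are avoided
    by a single normal subgroup of finite index (torsion_separated): if [M] is
    maximal among the normal subgroups that avoid them, every central element of
    [G1 / M] has finite order, and a finitely generated nilpotent group with
    such a centre is finite (finite_torsion_center_quotient). These [g]
    therefore contribute a bounded amount, which is absorbed since the growth
    function is at least 1. *)

Set Implicit Arguments.
Unset Strict Implicit.
Unset Printing Implicit Defensive.

Import Order.TTheory GRing.Theory Num.Theory.

Local Open Scope classical_set_scope.
Local Open Scope group_scope.

(** * Subgroups and quotient groups *)

Section Subgroups.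
Variable G : groupType.
Implicit Types (A H N : set G) (x y g : G).

Lemma subgroup1 H : subgroup H -> H 1. Proof. by case. Qed.

Lemma subgroupV H x : subgroup H -> H x -> H x^-1.
Proof. by case=> H1 HV Hx; rewrite -div1g; apply: HV. Qed.

Lemma subgroupM H x y : subgroup H -> H x -> H y -> H (x * y).
Proof.
by move=> sH Hx Hy; rewrite -[y]invgK; apply: sH.2 => //; apply: subgroupV.
Qed.

Lemma subgroupX H x n : subgroup H -> H x -> H (x ^+ n).
Proof.
move=> sH Hx; elim: n => [|n IH]; first exact: subgroup1.
by rewrite expgS; apply: subgroupM.
Qed.

Lemma normal_subgroupR N x g : normal_subgroup N -> N x -> N [~ x, g].
Proof.
move=> [sN nN] Nx; rewrite commgEl.
by apply: subgroupM => //; [apply: subgroupV | apply: nN].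
Qed.

Lemma subgroup_generated A : subgroup (generated A).
Proof.
split=> [B [[]]//|x y Ax Ay B BP].
by apply: BP.1.2; [apply: Ax | apply: Ay].
Qed.

Lemma generated_subset A H : subgroup H -> A `<=` H -> generated A `<=` H.
Proof. exact: smallest_sub. Qed.

Lemma normal_generated A : (forall x g, A x -> A (x ^ g)) ->
  normal_subgroup (generated A).
Proof.
move=> AJ; have sA := subgroup_generated A; split=> // x g gx.
suff: [set y | generated A (y ^ g)] x by [].
apply: generated_subset gx => [|y Ay]; last first.
  by apply: sub_gen_smallest; apply: AJ.
split=> [|y z gy gz] /=; first by rewrite conj1g; apply: subgroup1.
by rewrite conjMg conjVg; apply: sA.2.
Qed.

(** The elements of [s] meet all left cosets of [H]; repetitions are allowed, so
    that only upper bounds on the index can be read off. *)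
Definition covered_by_cosets (H : set G) (s : seq G) : Prop :=
  forall g, exists2 r, r \in s & H (r^-1 * g).

End Subgroups.

Section Quotient.
Variables (G : groupType) (N : set G).
Hypothesis nN : normal_subgroup N.

Definition coset_class (g : G) : set G := [set x | N (g^-1 * x)].

Lemma coset_classP g h : coset_class g = coset_class h <-> N (g^-1 * h).
Proof.
have [sN _] := nN; split=> [e|Ngh].
  suff : coset_class g h by [].
  by rewrite e /coset_class /= mulVg; apply: subgroup1.
apply/seteqP; split=> x; rewrite /coset_class /= => Nx.
  have -> : h^-1 * x = (g^-1 * h)^-1 * (g^-1 * x).
    by rewrite invgM invgK mulgA mulgK.
  by apply: subgroupM => //; apply: subgroupV.
have -> : g^-1 * x = (g^-1 * h) * (h^-1 * x) by rewrite mulgA mulgK.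
exact: subgroupM.
Qed.

(** The proof of normality is a parameter so that the group structure below can
    be found from the type alone. *)
Definition quotient_of of normal_subgroup N :=
  {X : set G | `[< exists g, X = coset_class g >]}.

HB.instance Definition _ := Choice.on (quotient_of nN).
Local Notation Q := (quotient_of nN).

Definition quotient_proj (g : G) : Q :=
  exist _ (coset_class g) (asboolT (ex_intro _ g erefl)).

Definition quotient_repr (q : Q) : G :=
  projT1 (cid (asboolW (valP q))).

Lemma quotient_reprK : cancel quotient_repr quotient_proj.
Proof.
move=> q; apply: val_inj => /=; rewrite /quotient_repr.
by case: cid => g /= ->.
Qed.

Lemma quotient_projP g h : quotient_proj g = quotient_proj h <-> N (g^-1 * h).
Proof.
rewrite -coset_classP; split=> [/(congr1 val)//|e].
exact: val_inj.
Qed.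

Lemma quotient_repr_proj g : N (g^-1 * quotient_repr (quotient_proj g)).
Proof. by apply/quotient_projP; rewrite quotient_reprK. Qed.

Definition quotient_mul p q :=
  quotient_proj (quotient_repr p * quotient_repr q).
Definition quotient_inv p := quotient_proj (quotient_repr p)^-1.

Lemma quotient_projM g h :
  quotient_proj (g * h) = quotient_mul (quotient_proj g) (quotient_proj h).
Proof.
apply/quotient_projP; have [sN cN] := nN.
set g' := quotient_repr _; set h' := quotient_repr _.
have -> : (g * h)^-1 * (g' * h') = (g^-1 * g') ^ h * (h^-1 * h').
  by rewrite conjgE invgM !mulgA mulgK.
by apply: subgroupM => //; [apply: cN|]; apply: quotient_repr_proj.
Qed.

Lemma quotient_projV g : quotient_proj g^-1 = quotient_inv (quotient_proj g).
Proof.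
apply/quotient_projP; have [sN cN] := nN.
set g' := quotient_repr _.
have -> : g^-1^-1 * g'^-1 = ((g^-1 * g')^-1) ^ g^-1.
  by rewrite conjgE !invgM !invgK !mulgA mulgK.
by apply: cN; apply: subgroupV => //; apply: quotient_repr_proj.
Qed.

Lemma quotient_mulA : associative quotient_mul.
Proof.
move=> p q r; rewrite -[p]quotient_reprK -[q]quotient_reprK -[r]quotient_reprK.
by rewrite -!quotient_projM mulgA.
Qed.

Lemma quotient_mul1 : left_id (quotient_proj 1) quotient_mul.
Proof. by move=> p; rewrite -[p]quotient_reprK -quotient_projM mul1g. Qed.

Lemma quotient_mulg1 : right_id (quotient_proj 1) quotient_mul.
Proof. by move=> p; rewrite -[p]quotient_reprK -quotient_projM mulg1. Qed.

Lemma quotient_mulV :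
  left_inverse (quotient_proj 1) quotient_inv quotient_mul.
Proof.
by move=> p; rewrite -[p]quotient_reprK -quotient_projV -quotient_projM mulVg.
Qed.

Lemma quotient_mulgV :
  right_inverse (quotient_proj 1) quotient_inv quotient_mul.
Proof.
by move=> p; rewrite -[p]quotient_reprK -quotient_projV -quotient_projM mulgV.
Qed.

HB.instance Definition _ := isGroup.Build Q
  quotient_mulA quotient_mul1 quotient_mulg1 quotient_mulV quotient_mulgV.

Lemma quotient_projF : {morph quotient_proj : x y / x / y}.
Proof. by move=> x y; rewrite quotient_projM quotient_projV. Qed.

HB.instance Definition _ := isGroupMorphism.Build G Q quotient_proj
  quotient_projF.

End Quotient.

(** All uses of quotients go through this statement: a computation modulo [N] is
    a computation with [pi]. *)
Lemma quotient_exists (G : groupType) (N : set G) : normal_subgroup N ->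
  exists (Q : groupType) (pi : UMagmaMorphism.type G Q),
  (forall q, exists g, pi g = q) /\ (forall g, pi g = 1 <-> N g).
Proof.
move=> nN; exists (quotient_of nN), (@quotient_proj _ _ nN); split=> [q|g].
  by exists (quotient_repr q); apply: quotient_reprK.
have -> : N g <-> N (1^-1 * g) by rewrite invg1 mul1g.
rewrite -(quotient_projP nN) gmulf1; split=> //.
Qed.

(** * Normal closures in nilpotent groups *)

Lemma commXg (G : groupType) (x g : G) n :
  commute x [~ x, g] -> [~ x ^+ n, g] = [~ x, g] ^+ n.
Proof.
move=> cx; rewrite [LHS]commgEl conjXg.
have -> : x ^ g = x * [~ x, g] by rewrite commgEl mulVKg.
by rewrite expgMn // mulKg.
Qed.

Lemma commgX (G : groupType) (x g : G) n :
  commute g [~ x, g] -> [~ x, g ^+ n] = [~ x, g] ^+ n.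
Proof.
move=> cg; rewrite -[LHS]invgR commXg; first by rewrite -expVgn invgR.
by rewrite -invgR; apply: commuteV.
Qed.

Section CommutatorsModulo.
Variable G : groupType.
Implicit Types (A K N : set G) (x y g : G).

(** Modulo [N] the commutator [[~ x, g]] is central, so commutation with [g] is
    multiplicative in [x] and in [g]: both sides are [[~ x, g] ^+ (k * m)]. *)
Lemma commX_modulo N x g k m : normal_subgroup N ->
    (forall y, N [~ [~ x, g], y]) ->
  N ([~ x, g ^+ k] ^+ m) <-> N [~ x ^+ (k * m), g].
Proof.
move=> nN Ncomm; have [Q [pi [_ kerpi]]] := quotient_exists nN.
have cpi y : commute (pi y) [~ pi x, pi g].
  apply: commute_sym; apply/commgP/eqP.
  by rewrite -!gmulfR; apply/kerpi.
rewrite -!kerpi gmulfXn !gmulfR !gmulfXn.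
rewrite (commgX k (cpi g)) (commXg (k * m)%N (cpi x)).
by rewrite expgnA.
Qed.

Definition central_modulo N : set G := [set x | forall g, N [~ x, g]].

Lemma normal_central_modulo N : normal_subgroup N ->
  normal_subgroup (central_modulo N).
Proof.
move=> nN; have [Q [pi [_ kerpi]]] := quotient_exists nN.
have cmP x : central_modulo N x <-> forall g, commute (pi x) (pi g).
  split=> h g; last by apply/kerpi; rewrite gmulfR; apply/eqP/commgP.
  by apply/commgP/eqP; rewrite -gmulfR; apply/kerpi.
split; first split.
- by apply/cmP => g; rewrite gmulf1; apply: commute_sym; apply: commute1.
- move=> x y /cmP cx /cmP cy; apply/cmP => g; rewrite gmulfF.
  apply: commute_sym; apply: commuteM; first exact: commute_sym.
  by apply: commuteV; apply: commute_sym.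
- move=> x g /cmP cx; apply/cmP => h.
  by rewrite gmulfJ /conjg cx mulKg; apply: cx.
Qed.

Fixpoint upper_central_modulo N (i : nat) : set G :=
  if i is j.+1 then central_modulo (upper_central_modulo N j) else N.

Lemma normal_upper_central_modulo N i : normal_subgroup N ->
  normal_subgroup (upper_central_modulo N i).
Proof. by move=> nN; elim: i => //= i; apply: normal_central_modulo. Qed.

Lemma subset_upper_central_modulo N i : normal_subgroup N ->
  N `<=` upper_central_modulo N i.
Proof.
move=> nN; elim: i => //= i IH x Nx g.
by apply: IH; apply: normal_subgroupR.
Qed.

(** The lower central series, read upwards from its trivial term, stays below
    the upper central series modulo any [N]. *)
Lemma nilpotent_upper_central_modulo c N : normal_subgroup N ->
  @lower_central_series G c = [set 1] -> upper_central_modulo N c = setT.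
Proof.
move=> nN Gc; rewrite -subTset.
suff sub i : (i <= c)%N ->
    @lower_central_series G (c - i) `<=` upper_central_modulo N i.
  by have := sub c (leqnn c); rewrite subnn.
elim: i => [_|i IH ltic x Gx g].
  by rewrite subn0 Gc => _ ->; apply: subgroup1 nN.1.
apply: IH (ltnW ltic) _ _; rewrite subnS in Gx.
have -> : (c - i = (c - i).-1.+1)%N by rewrite prednK // subn_gt0.
by apply: sub_gen_smallest; exists x, g.
Qed.

End CommutatorsModulo.

Section Roots.
Variable G : groupType.
Implicit Types (A H K N X : set G) (x y g : G).

Definition normal_core N : set G := [set x | forall g, N (x ^ g)].

Lemma normal_normal_core N : subgroup N -> normal_subgroup (normal_core N).
Proof.
move=> sN; split; first split=> [g|x y Kx Ky g].
- by rewrite conj1g; apply: subgroup1.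
- by rewrite conjMg conjVg; apply: sN.2.
- by move=> x g Kx h; rewrite -conjgM.
Qed.

(** One factor [k] moves a commutator with [g ^+ k] to one with [g]; the two
    factors [core_exponent k j] come from the two uses of the induction
    hypothesis in expg_core_exponent. *)
Fixpoint core_exponent (k i : nat) : nat :=
  if i is j.+1 then (k * core_exponent k j * core_exponent k j)%N else 1%N.

Lemma core_exponent_gt0 k i : (0 < k)%N -> (0 < core_exponent k i)%N.
Proof. by move=> k0; elim: i => //= i IH; rewrite !muln_gt0 k0 IH. Qed.

(** Let [Z_i] be the upper central series modulo the core. For [x] in [N] and in
    [Z_(i+2)], the commutator [[~ x, g ^+ k]] is in [N] and in [Z_(i+1)], so by
    induction a bounded power of it is in the core. Modulo [Z_i] this power is
    [[~ x ^+ (k * m), g]], for every [g]; thus [x ^+ (k * m)] drops to [Z_(i+1)]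
    and the induction hypothesis applies again. *)
Lemma expg_core_exponent N k i x : subgroup N ->
    (forall y g, N y -> N [~ y, g ^+ k]) ->
    N x -> upper_central_modulo (normal_core N) i x ->
  normal_core N (x ^+ core_exponent k i).
Proof.
move=> sN Nk; have nK := normal_normal_core sN.
elim: i x => [|[|i] IH] x Nx Zx; first by [].
  apply: (subgroupX _ nK.1) => g.
  have -> : x ^ g = x * [~ x, g] by rewrite commgEl mulVKg.
  apply: subgroupM => //; rewrite -[[~ x, g]]conjg1; exact: Zx.
have nZ := normal_upper_central_modulo i nK.
rewrite -[core_exponent _ _]/(k * core_exponent k i.+1 *
  core_exponent k i.+1)%N.
rewrite expgnA.
apply: (IH); first exact: subgroupX.
move=> g; apply/(commX_modulo _ _ nZ); first exact: Zx.
apply: (subset_upper_central_modulo _ nK).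
(* The induction hypothesis is used for the commutator itself. *)
apply: IH; first exact: Nk.
exact: Zx.
Qed.

(** The subgroup [[A, G] K]. *)
Definition commutator_modulo K A : set G :=
  generated (K `|` [set z | exists x g, A x /\ z = [~ x, g]]).

Lemma normal_commutator_modulo K A :
    normal_subgroup K -> normal_subgroup A ->
  normal_subgroup (commutator_modulo K A).
Proof.
move=> nK nA; apply: normal_generated => x h [Kx|[y [g [Ay ->]]]].
  by left; apply: nK.2.
by right; exists (y ^ h), (g ^ h); rewrite conjRg; split=> //; apply: nA.2.
Qed.

(** [generated X] is abelian modulo its commutators with [G], so there the
    [m]-th power map is a morphism and may be tested on generators. *)
Lemma expg_commutator_modulo K X m a :
    normal_subgroup K -> normal_subgroup (generated X) ->
    (forall x, X x -> commutator_modulo K (generated X) (x ^+ m)) ->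
  generated X a -> commutator_modulo K (generated X) (a ^+ m).
Proof.
move=> nK nX Xm; set B := commutator_modulo K _ => gXa.
have nB : normal_subgroup B by apply: normal_commutator_modulo.
suff [] : [set y | generated X y /\ B (y ^+ m)] a by [].
apply: generated_subset gXa => [|x Xx]; last first.
  by split; [apply: sub_gen_smallest | apply: Xm].
split=> [|x y [gx Bx] [gy By]].
  by split; [apply: subgroup1 nX.1|rewrite expg1n; apply: subgroup1 nB.1].
split; first exact: nX.1.2.
have [Q [pi [_ kerpi]]] := quotient_exists nB.
apply/kerpi; rewrite gmulfXn gmulfF expgnFl; last first.
  apply/commgP/eqP; rewrite -gmulfR; apply/kerpi.
  by apply: sub_gen_smallest; right; exists x, y.
by rewrite -!gmulfXn -gmulfF; apply/kerpi; apply: nB.1.2.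
Qed.

(** Commutation with [g] carries the hypothesis from [A] to [[A, G] K], since
    modulo [[[A, G], G] K] it turns [m]-th powers into [m]-th powers. Each step
    costs one factor [m] and goes down one term of the upper central series. *)
Lemma expg_upper_central_modulo K A m j a :
    normal_subgroup K -> normal_subgroup A -> A `<=` upper_central_modulo K j ->
    (forall x, A x -> commutator_modulo K A (x ^+ m)) ->
  A a -> K (a ^+ (m ^ j)).
Proof.
move=> nK; elim: j A a => [|j IH] A a nA AZ Am Aa; first exact: AZ.
have nA' := normal_commutator_modulo nK nA.
rewrite expnS expgnA; apply: (IH (commutator_modulo K A)) => //.
- apply: generated_subset; first exact: (normal_upper_central_modulo j nK).1.
  move=> x [Kx|[y [g [Ay ->]]]]; first exact: subset_upper_central_modulo.
  exact: AZ.
- move=> x; apply: expg_commutator_modulo => // {}x.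
  have nA'' := normal_commutator_modulo nK nA'.
  case=> [Kx|[y [g [Ay ->]]]].
    by apply: sub_gen_smallest; left; apply: subgroupX nK.1 Kx.
  rewrite -[[~ y, g]]/[~ y, g ^+ 1]; apply/(commX_modulo _ _ nA'').
    move=> h; apply: sub_gen_smallest; right; exists [~ y, g], h; split=> //.
    by apply: sub_gen_smallest; right; exists y, g.
  rewrite mul1n; apply: sub_gen_smallest; right; exists (y ^+ m), g.
  by split=> //; apply: Am.
- exact: Am.
Qed.

Definition normal_closure N : set G :=
  generated [set z | exists x g, N x /\ z = x ^ g].

Lemma normal_normal_closure N : normal_subgroup (normal_closure N).
Proof.
apply: normal_generated => x h [y [g [Ny ->]]].
by exists y, (g * h); rewrite conjgM.
Qed.

Lemma subset_normal_closure N : N `<=` normal_closure N.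
Proof.
by move=> x Nx; apply: sub_gen_smallest; exists x, 1; rewrite conjg1.
Qed.

(** The exponent [m] is chosen before [N]: this uniformity is what makes the
    comparison of growth functions linear. *)
Lemma normal_closure_root k : nilpotent_group G -> (0 < k)%N ->
  exists2 m : nat, (0 < m)%N & forall N, subgroup N ->
    (forall y g, N y -> N [~ y, g ^+ k]) ->
    forall x, normal_closure N x -> N (x ^+ m).
Proof.
move=> [c Gc] k0; have e0 := core_exponent_gt0 c k0.
exists (core_exponent k c ^ c)%N; first by rewrite expn_gt0 e0.
move=> N sN Nk x Mx; have nK := normal_normal_core sN.
have Zc := nilpotent_upper_central_modulo nK Gc.
(* It is enough to land in the normal core of [N]. *)
rewrite -[_ ^+ _]conjg1; move: {1}1; rewrite -/(normal_core N _).
have nM := normal_normal_closure N.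
apply: (expg_upper_central_modulo nK nM _ _ Mx) => [|y].
  by rewrite Zc.
apply: expg_commutator_modulo => // _ [z [g [Nz ->]]].
rewrite -conjXg; apply: sub_gen_smallest; left.
by apply: nK.2; apply: expg_core_exponent => //; rewrite Zc.
Qed.

End Roots.

(** * Separating torsion elements *)

Lemma expgn_modn (Q : groupType) (x : Q) n i :
  x ^+ n = 1 -> x ^+ i = x ^+ (i %% n).
Proof.
by move=> xn; rewrite {1}(divn_eq i n) expgnDr mulnC expgnA xn expg1n mul1g.
Qed.

Lemma finite_pigeonhole (T : Type) (F : set T) (f : nat -> T) :
  finite_set F -> (forall n, F (f n)) -> exists i j, (i < j)%N /\ f i = f j.
Proof.
move=> finF Ff; apply: contrapT => noij; apply: infinite_nat.
have -> : [set: nat] = f @^-1` F by apply/seteqP; split=> n _ //; apply: Ff.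
apply: finite_preimage finF => i j _ _ fij.
by case: (ltngtP i j) => // ltij; case: noij; [exists i, j | exists j, i].
Qed.

Definition torsion_center (Q : groupType) : Prop :=
  forall z : Q, (forall g, commute z g) -> exists2 d, (0 < d)%N & z ^+ d = 1.

Section FiniteSeries.
Variable Q : groupType.
Implicit Types (F : set Q) (a g : Q).

(** The commutators [[~ a ^+ n, g]] stay in the finite set [F], so two of them
    agree, for exponents [i < j]; then [a ^+ (j - i)] commutes with [g]. *)
Lemma commute_expg_finite F a g : finite_set F -> normal_subgroup F ->
    (forall y, F [~ a, y]) ->
  exists2 d, (0 < d)%N & commute (a ^+ d) g.
Proof.
move=> finF nF Fa.
have nFF : forall y, F [~ [~ a, g], y].
  by move=> y; apply: normal_subgroupR.
have FX n : F [~ a ^+ n, g].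
  rewrite -[n]mul1n; apply/(commX_modulo _ _ nF) => //.
  by apply: subgroupX nF.1 _; apply: Fa.
have [i [j [ltij eij]]] := finite_pigeonhole finF FX.
exists (j - i)%N; first by rewrite subn_gt0.
apply/commgP/eqP; set b := a ^+ (j - i).
have aj : a ^+ j = b * a ^+ i by rewrite -expgnDr subnK // ltnW.
move: eij; rewrite aj !commgEl conjMg invgM.
move: (b ^ g) ((a ^+ i) ^ g) => u v; rewrite -!mulgA => /mulgI.
by rewrite mulgA -[LHS]mul1g => /mulIg.
Qed.

Lemma commute_expg_seq F a (s : seq Q) : finite_set F -> normal_subgroup F ->
    (forall y, F [~ a, y]) ->
  exists2 d, (0 < d)%N & {in s, forall g, commute (a ^+ d) g}.
Proof.
move=> finF nF Fa; elim: s => [|g s [d d0 cd]]; first by exists 1%N.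
have [e e0 ce] := commute_expg_finite g finF nF Fa.
exists (d * e)%N; first by rewrite muln_gt0 d0.
move=> h; rewrite inE => /predU1P[->|hs]; apply: commute_sym.
  by rewrite mulnC expgnA; apply: commuteX; apply: commute_sym.
by rewrite expgnA; apply: commuteX; apply: commute_sym; apply: cd.
Qed.

Lemma generated_commute (A : set Q) a : generated A = setT ->
  (forall g, A g -> commute a g) -> forall g, commute a g.
Proof.
move=> genA cA g; suff: [set g | commute a g] g by [].
have: generated A g by rewrite genA.
apply: generated_subset => //; split=> [|x y cx cy]; first exact: commute1.
by apply: commuteM => //; apply: commuteV.
Qed.

Variable s : seq Q.
Hypothesis gens : generated [set` s] = setT.
Hypothesis torsZ : torsion_center Q.

(** Since the group is generated by finitely many elements, some power of [a] is
    central, hence of finite order. So [a] has finite order, and the subgroup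
    generated by [F] and [a] is finite; it is normal as [a] is central modulo
    [F]. *)
Lemma finite_normal_extension F a : finite_set F -> normal_subgroup F ->
    (forall y, F [~ a, y]) ->
  exists F', [/\ finite_set F', normal_subgroup F', F `<=` F' & F' a].
Proof.
move=> finF nF Fa.
have [d d0 cd] := commute_expg_seq s finF nF Fa.
have [|e e0 ade] := torsZ (z := a ^+ d); first exact: generated_commute cd.
have [P [pi [_ kerpi]]] := quotient_exists nF.
pose n := (d * e)%N; have an : a ^+ n = 1 by rewrite expgnA.
have pian : pi a ^+ n = 1 by rewrite -gmulfXn an gmulf1.
have n0 : (0 < n)%N by rewrite muln_gt0 d0.
have cpi y : commute (pi y) (pi a).
  by apply: commute_sym; apply/commgP/eqP; rewrite -gmulfR; apply/kerpi.
exists [set x | exists i, pi x = pi a ^+ i]; split.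
- apply: (@sub_finite_set _ _ [set a ^+ i * f | i in `I_n & f in F]).
    move=> x [i pix]; exists (i %% n)%N; first by rewrite /= ltn_mod.
    exists ((a ^+ (i %% n))^-1 * x); last by rewrite mulVKg.
    apply/kerpi; rewrite gmulfM gmulfV gmulfXn pix.
    by rewrite -(expgn_modn i pian) mulVg.
  by apply: finite_image2 => //; apply: finite_II.
- split; first split; first by exists 0%N; rewrite gmulf1.
  + move=> x y [i pix] [j piy]; exists (i + (n - j %% n))%N.
    rewrite gmulfF pix piy expgnDr; congr (_ * _).
    rewrite (expgn_modn j pian); apply: (mulIg (pi a ^+ (j %% n))).
    by rewrite mulVg -expgnDr subnK // ltnW // ltn_mod.
  + move=> x g [i pix]; exists i; rewrite gmulfJ pix.
    have c : commute (pi a ^+ i) (pi g).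
      by apply: commute_sym; apply: commuteX.
    by rewrite /conjg c mulKg.
- by move=> x Fx; exists 0%N; apply/kerpi.
- by exists 1%N; rewrite expg1.
Qed.

Lemma finite_normal_extension_seq F (t : seq Q) :
    finite_set F -> normal_subgroup F ->
    {in t, forall a y, F [~ a, y]} ->
  exists F', [/\ finite_set F', normal_subgroup F', F `<=` F' &
    forall a, a \in t -> F' a].
Proof.
move=> finF nF; elim: t => [|a t IH] Ft; first by exists F; split.
have [|F1 [fin1 n1 F1F F1t]] := IH.
  by move=> x xt; apply: Ft; rewrite in_cons xt orbT.
have [|F2 [fin2 n2 F2F1 F2a]] := @finite_normal_extension F1 a fin1 n1.
  by move=> y; apply: F1F; apply: Ft; rewrite mem_head.
exists F2; split=> //; first exact: subset_trans F2F1.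
by move=> x; rewrite inE => /predU1P[->//|xt]; apply: F2F1; apply: F1t.
Qed.

End FiniteSeries.

Section TorsionSeparation.
Variable G : groupType.
Local Notation gamma := (@lower_central_series G).

Lemma lower_central_series_step i x g : gamma i x -> gamma i.+1 [~ x, g].
Proof. by move=> gx; apply: sub_gen_smallest; exists x, g. Qed.

Lemma subgroup_lower_central_series i : subgroup (gamma i).
Proof. by case: i => [|i]; [split | apply: subgroup_generated]. Qed.

Lemma normal_lower_central_series i : normal_subgroup (gamma i).
Proof.
elim: i => [|i [_ nG]].
  by split; first exact: subgroup_lower_central_series.
apply: normal_generated => x h [u [v [gu ->]]].
by exists (u ^ h), (v ^ h); rewrite conjRg; split=> //; apply: nG.
Qed.

Lemma lower_central_series_subset i : gamma i.+1 `<=` gamma i.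
Proof.
apply: generated_subset; first exact: subgroup_lower_central_series.
move=> _ [x [g [gx ->]]].
exact: normal_subgroupR (normal_lower_central_series i) gx.
Qed.

Lemma subgroup_commute_preimage (Q : groupType) (pi : UMagmaMorphism.type G Q)
    (q : Q) :
  subgroup [set x | commute q (pi x)].
Proof.
split=> [|x y cx cy] /=; first by rewrite gmulf1; apply: commute1.
by rewrite gmulfF; apply: commuteM => //; apply: commuteV.
Qed.

(** If [S] generates [G] and [X] generates [gamma i] modulo [gamma i.+1], then
    the commutators of [X] with [S] generate [gamma i.+1] modulo [gamma i.+2].
    Indeed, modulo a subgroup [W] that contains both, the elements of [X] and of
    [gamma i.+1] commute with [S]; centralisers being subgroups, all of
    [gamma i] then commutes with all of [G]. *)
Lemma lower_central_series_fg (S : set G) i : finite_generating_set S ->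
  exists2 X : seq G, (forall x, x \in X -> gamma i x) &
    forall W, subgroup W -> gamma i.+1 `<=` W -> (forall x, x \in X -> W x) ->
      gamma i `<=` W.
Proof.
move=> [/finite_seqP[s Ss] gS]; elim: i => [|i [X Xi genX]].
  exists s => // W sW _ sW'; rewrite [gamma 0]/= -gS Ss.
  by apply: generated_subset => // x; apply: sW'.
exists [seq [~ x, g] | x <- X, g <- s] => [z /allpairsP[[x g] /= [xX _ ->]]|].
  by apply: lower_central_series_step; apply: Xi.
move=> W0 sW0 W0g W0X.
suff: gamma i.+1 `<=` W0 `&` gamma i.+1 by move=> sub x /sub[].
(* Below [gamma i.+1], a subgroup containing [gamma i.+2] is normal. *)
set W := W0 `&` gamma i.+1.
have [sg _] := normal_lower_central_series i.+1.
have gW : gamma i.+2 `<=` W.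
  by move=> x gx; split; [apply: W0g | exact: lower_central_series_subset gx].
have nW : normal_subgroup W.
  split; first split=> [|x y [Wx gx] [Wy gy]].
  - by split; apply: subgroup1.
  - by split; [apply: sW0.2 | apply: sg.2].
  move=> x g Wx; have -> : x ^ g = x * [~ x, g] by rewrite commgEl mulVKg.
  have [Wg gg] : W [~ x, g].
    by apply: gW; apply: lower_central_series_step; case: Wx.
  by case: Wx => Wx gx; split; [exact: subgroupM | exact: (subgroupM sg)].
have [Q [pi [_ kerpi]]] := quotient_exists nW.
have cP x y : commute (pi x) (pi y) <-> W [~ x, y].
  rewrite -kerpi gmulfR; split=> [/commgP/eqP //|e].
  by apply/commgP/eqP.
apply: generated_subset; first exact: nW.1.
move=> _ [x [g [gx ->]]]; apply/cP.
suff: [set g | commute (pi x) (pi g)] g by [].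
have: generated S g by rewrite gS.
apply: generated_subset; first exact: subgroup_commute_preimage.
rewrite Ss => {}g gs; apply: commute_sym.
suff: [set y | commute (pi g) (pi y)] x by [].
apply: genX gx; first exact: subgroup_commute_preimage.
  move=> y gy; apply: commute_sym; apply/cP; apply: gW.
  exact: lower_central_series_step.
move=> y yX; apply: commute_sym; apply/cP; split.
  by apply: W0X; apply/allpairsP; exists (y, g).
by apply: lower_central_series_step; apply: Xi.
Qed.

(** Going up the lower central series, finite normal subgroups of [Q] are built
    that contain the images of its terms: each term is generated modulo the
    next one by finitely many elements, whose images are central modulo the
    finite subgroup already built. *)
Lemma finite_torsion_center_quotient (S : set G) (Q : groupType)
    (pi : UMagmaMorphism.type G Q) :
    nilpotent_group G -> finite_generating_set S ->
    (forall q, exists g, pi g = q) -> torsion_center Q ->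
  finite_set [set: Q].
Proof.
move=> [c Gc] fgS surj torsZ; have [/finite_seqP[s Ss] gS] := fgS.
have gQ : generated [set` map pi s] = setT.
  rewrite -subTset => q _; have [g <-] := surj q.
  suff: [set g | generated [set` map pi s] (pi g)] g by [].
  have sQ := subgroup_generated [set` map pi s].
  have: generated S g by rewrite gS.
  apply: generated_subset => [|x].
    split=> [|x y gx gy]; first by rewrite /= gmulf1; apply: subgroup1.
    by rewrite /= gmulfF; apply: sQ.2.
  by rewrite Ss => xs; apply: sub_gen_smallest; apply: map_f.
suff series i : (i <= c)%N -> exists F,
    [/\ finite_set F, normal_subgroup F &
      forall x, gamma (c - i) x -> F (pi x)].
  have [F [finF _ FG]] := series c (leqnn c).
  apply: sub_finite_set finF => q _; have [g <-] := surj q.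
  by apply: FG; rewrite subnn.
elim: i => [_|i IH ltic].
  exists [set 1]; split=> //.
    split; first by split=> // x y -> ->; rewrite divg1.
    by move=> x g ->; rewrite conj1g.
  by rewrite subn0 Gc => x ->; rewrite gmulf1.
have [F [finF nF Fg]] := IH (ltnW ltic).
have ci : (c - i = (c - i.+1).+1)%N by rewrite subnSK.
have [X Xg genX] := lower_central_series_fg (c - i.+1) fgS.
have [|F' [finF' nF' FF' F'X]] :=
    finite_normal_extension_seq gQ torsZ (t := map pi X) finF nF.
  move=> _ /mapP[x xX ->] y; have [g <-] := surj y; rewrite -gmulfR.
  by apply: Fg; rewrite ci; apply: lower_central_series_step; apply: Xg.
exists F'; split=> //; apply: genX.
- split=> [|x y F'x F'y]; first by rewrite /= gmulf1; apply: subgroup1 nF'.1.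
  by rewrite /= gmulfF; apply: nF'.1.2.
- by move=> x; rewrite -ci => gx; apply: FF'; apply: Fg.
- by move=> x xX; apply: F'X; apply: map_f.
Qed.

(** The preimage of the cyclic group generated by the central element [z]; the
    two exponents stand for the integer [j - i]. *)
Lemma normal_preimage_powers (Q : groupType) (pi : UMagmaMorphism.type G Q)
    (z : Q) : (forall q, commute z q) ->
  normal_subgroup [set x | exists i j, pi x * z ^+ i = z ^+ j].
Proof.
move=> cz; have czX i q : commute q (z ^+ i).
  by apply: commuteX; apply: commute_sym.
split; first split.
- by exists 0%N, 0%N; rewrite gmulf1 mulg1.
- move=> x y [i [j exz]] [k [l eyz]]; exists (i + l)%N, (j + k)%N.
  rewrite gmulfF -mulgA expgnDr [_ * z ^+ l]czX -eyz.
  by rewrite -(mulgA (pi y)) mulKg -(czX k) mulgA exz expgnDr.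
- move=> x g [i [j exz]]; exists i, j.
  by rewrite gmulfJ /conjg -!mulgA (czX i) (mulgA (pi x)) exz -(czX j) mulKg.
Qed.

(** Let [M] be maximal among the normal subgroups that avoid the nontrivial
    solutions of [h ^+ m = 1]. If [z] is central and nontrivial in [G / M], the
    preimage of the group generated by [z] contains such an [h], by maximality;
    its image is a nontrivial power of [z] of finite order, so [z] itself has
    finite order. *)
Lemma torsion_separated (S : set G) m :
    nilpotent_group G -> finite_generating_set S -> (0 < m)%N ->
  exists (M : set G) s, [/\ normal_subgroup M, covered_by_cosets M s &
    forall h, h ^+ m = 1 -> M h -> h = 1].
Proof.
move=> nilG fgS m0.
(* The empty set is allowed, so that the empty chain has an upper bound. *)
pose P : set (set G) := [set A | [/\ forall x y, A x -> A y -> A (x / y),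
  forall x g, A x -> A (x ^ g) & forall h, h ^+ m = 1 -> A h -> h = 1]].
have [F FP totF|M [[MF MJ Mtors] maxM]] := @Zorn_bigcup _ P.
  split.
  - move=> x y [A FA Ax] [B FB By].
    have [AB|BA] := totF _ _ FA FB.
      by exists B => //; have [BF _ _] := FP _ FB; apply: BF => //; apply: AB.
    by exists A => //; have [AF _ _] := FP _ FA; apply: AF => //; apply: BA.
  - by move=> x g [A FA Ax]; exists A => //;
      have [_ AJ _] := FP _ FA; apply: AJ.
  - by move=> h hm [A FA Ah]; have [_ _ At] := FP _ FA; apply: At.
have M1 : M 1.
  apply: contrapT => nM1; apply: (maxM [set 1]); last first.
    split; first by move=> x y -> ->; rewrite divg1.
      by move=> x g ->; rewrite conj1g.
    by [].
  split=> [x Mx|sub]; last by apply: nM1; apply: sub.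
  by case: nM1; rewrite -(mulgV x); apply: MF.
have nM : normal_subgroup M by [].
have [Q [pi [surj kerpi]]] := quotient_exists nM.
have torsZ : torsion_center Q.
  move=> z cz; have czX i q : commute q (z ^+ i).
    by apply: commuteX; apply: commute_sym.
  have [z1|z1] := pselect (z = 1); first by exists 1%N.
  have [B1 B2] := normal_preimage_powers pi cz.
  set B := [set x | _] in B1 B2.
  have [h [hm Bh h1]] : exists h, [/\ h ^+ m = 1, B h & h <> 1].
    apply: contrapT => noh; apply: (maxM B); last first.
      split; [exact: B1.2 | exact: B2 |] => h hm Bh.
      by apply: contrapT => h1; apply: noh; exists h.
    split=> [x Mx|BM].
      by exists 0%N, 0%N; rewrite mulg1; apply/kerpi.
    have [x pix] := surj z; apply: z1; rewrite -pix; apply/kerpi; apply: BM.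
    by exists 0%N, 1%N; rewrite pix mulg1.
  have [i [j eij]] := Bh.
  have eijm : z ^+ (i * m) = z ^+ (j * m).
    rewrite (expgnA _ j) -eij expgMn; last exact: czX.
    by rewrite -gmulfXn hm gmulf1 mul1g expgnA.
  have tors k l : (k < l)%N -> z ^+ (k * m) = z ^+ (l * m) ->
      exists2 d, (0 < d)%N & z ^+ d = 1.
    move=> ltkl e; exists ((l - k) * m)%N.
      by rewrite muln_gt0 subn_gt0 ltkl.
    apply: (mulIg (z ^+ (k * m))).
    by rewrite -expgnDr mul1g -mulnDl subnK // ltnW.
  case: (ltngtP i j) => [ltij|ltji|eqij]; first exact: tors ltij _.
    exact: tors ltji _.
  case: h1; apply: Mtors => //; apply/kerpi.
  by apply: (mulIg (z ^+ i)); rewrite eij eqij mul1g.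
have finQ := finite_torsion_center_quotient nilG fgS surj torsZ.
have [s Qs] := (finite_seqP _).1 finQ.
pose lift q := projT1 (cid (surj q)).
have liftK q : pi (lift q) = q by rewrite /lift; case: cid.
exists M, (map lift s); split=> // g; exists (lift (pi g)).
  by apply: map_f; have : [set: Q] (pi g) by []; rewrite Qs.
by apply/kerpi; rewrite gmulfM gmulfV liftK mulVg.
Qed.

End TorsionSeparation.

(** * Indices and word norms *)

Section Index.
Variable G : groupType.
Implicit Types (H M : set G) (x y g : G).

Lemma seq_of_left_cosets H : subgroup H ->
  exists r : set G -> G, forall g, H ((r [set g * h | h in H])^-1 * g).
Proof.
move=> sH; exists (fun X => xget 1 [set g | [set g * h | h in H] = X]) => g.
set X := [set g * h | h in H].
have /= eX := @xgetI _ 1 [set g | [set g * h | h in H] = X] g erefl.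
have : X g by exists 1; [apply: subgroup1 | rewrite mulg1].
by rewrite -{1}eX => -[h Hh <-]; rewrite mulKg.
Qed.

Lemma finite_index_covered H : subgroup H -> finite_index H ->
  exists s, covered_by_cosets H s.
Proof.
move=> sH /finite_seqP[t Ht]; have [r rP] := seq_of_left_cosets sH.
exists (map r t) => g; exists (r [set g * h | h in H]); last exact: rP.
apply: map_f; suff : left_cosets H [set g * h | h in H] by rewrite Ht.
by exists g.
Qed.

Variable R : realType.

Lemma subgroup_index_covered H : subgroup H ->
  subgroup_index R H = +oo%E \/
  exists2 s, covered_by_cosets H s & subgroup_index R H = ((size s)%:R)%:E.
Proof.
move=> sH; rewrite /subgroup_index /counting.
case: asboolP => [finH|]; last by left.
right; have [r rP] := seq_of_left_cosets sH.
exists [seq r X | X <- enum_fset (fset_set (left_cosets H))] => [g|].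
  exists (r [set g * h | h in H]); last exact: rP.
  by apply: map_f; rewrite in_fset_set //; apply/mem_set; exists g.
by rewrite size_map.
Qed.

Lemma subgroup_index_le H s : subgroup H -> covered_by_cosets H s ->
  (subgroup_index R H <= ((size s)%:R)%:E)%E.
Proof.
move=> sH Hs; pose t := [seq [set r * h | h in H] | r <- s].
have sub : left_cosets H `<=` [set` t].
  move=> _ [g _ <-]; have [r rs Hr] := Hs g.
  apply/mapP; exists r => //; apply/seteqP; split=> _ [h Hh <-].
    by exists (r^-1 * g * h); [apply: subgroupM | rewrite -mulgA mulVKg].
  exists ((r^-1 * g)^-1 * h); first by apply: subgroupM => //; apply: subgroupV.
  by rewrite invgM invgK -mulgA mulVKg.
have finH : finite_set (left_cosets H).
  by apply: sub_finite_set sub _; apply/finite_seqP; exists t.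
rewrite /subgroup_index /counting asboolT // lee_fin ler_nat.
rewrite -(size_map (fun r => [set r * h | h in H]) s).
apply: uniq_leq_size; first exact: fset_uniq.
by move=> X; rewrite in_fset_set // => /set_mem /sub.
Qed.

Lemma subgroup_index_ge1 H : subgroup H -> (1 <= subgroup_index R H)%E.
Proof.
move=> sH; have [->|[s Hs ->]] := subgroup_index_covered sH; first exact: leey.
have [r rs _] := Hs 1.
by rewrite lee_fin -[1%R]/(1%:R)%R ler_nat; case: s rs {Hs}.
Qed.

(** Among the powers of [g] with exponents from 0 to [size s], two lie in the
    same left coset, and the difference of the exponents divides [(size s)`!].
    *)
Lemma covered_expg H s : subgroup H -> covered_by_cosets H s ->
  forall g, H (g ^+ (size s)`!).
Proof.
move=> sH Hs g.
pose c i := xget 1 [set r | r \in s /\ H (r^-1 * g ^+ i)].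
have cP i : c i \in s /\ H ((c i)^-1 * g ^+ i).
  have [r rs Hr] := Hs (g ^+ i).
  exact: (@xgetI _ 1 [set r | r \in s /\ H (r^-1 * g ^+ i)] r).
have : ~~ uniq (map c (iota 0 (size s).+1)).
  apply/negP => /uniq_leq_size le.
  have /le : {subset map c (iota 0 (size s).+1) <= s}.
    by move=> _ /mapP[i _ ->]; case: (cP i).
  by rewrite size_map size_iota ltnn.
move=> /(uniqPn 1)[i [j [ltij]]]; rewrite size_map size_iota => ltjs.
have ltis := ltn_trans ltij ltjs.
rewrite !(nth_map 0%N) ?size_iota // !nth_iota // !add0n => eij.
have Hd : H (g ^+ (j - i)).
  have -> : g ^+ (j - i) = ((c i)^-1 * g ^+ i)^-1 * ((c j)^-1 * g ^+ j).
    rewrite eij invgM invgK -mulgA mulVKg.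
    by rewrite -{2}(subnKC (ltnW ltij)) expgnDr mulKg.
  apply: subgroupM => //; last exact: (cP j).2.
  by apply: subgroupV => //; apply: (cP i).2.
have /dvdnP[q ->] : (j - i %| (size s)`!)%N.
  apply: dvdn_fact; rewrite subn_gt0 ltij /=.
  exact: leq_trans (leq_subr i j) ltjs.
by rewrite mulnC expgnA; apply: subgroupX.
Qed.

End Index.

Section WordNorm.
Variable G : groupType.
Implicit Types (S : set G) (g : G) (w : seq G).

Definition word_for S g w : Prop :=
  (forall s, s \in w -> S s \/ S s^-1) /\ g = \prod_(s <- w) s.

Lemma word_for_mul S g h v w :
  word_for S g v -> word_for S h w -> word_for S (g * h) (v ++ w).
Proof.
move=> [Sv ->] [Sw ->]; split=> [s|]; last by rewrite big_cat.
by rewrite mem_cat => /orP[/Sv|/Sw].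
Qed.

Lemma word_for_inv S g w :
  word_for S g w -> word_for S g^-1 (rev [seq x^-1 | x <- w]).
Proof.
move=> [Sw ->]; split=> [s|].
  rewrite mem_rev => /mapP[a /Sw aS ->]; rewrite invgK.
  by case: aS; [right|left].
elim: w {Sw} => [|a w IH]; first by rewrite !big_nil invg1.
by rewrite /= rev_cons -cats1 big_cat big_cons big_seq1 invgM IH.
Qed.

Lemma word_for_expg S g w n : word_for S g w ->
  exists2 v, word_for S (g ^+ n) v & size v = (n * size w)%N.
Proof.
move=> Sw; elim: n => [|n [v Sv sv]].
  by exists [::] => //; split=> //; rewrite big_nil.
exists (w ++ v); first by rewrite expgS; apply: word_for_mul.
by rewrite size_cat sv mulSn.
Qed.

Lemma word_for_exists S g : generated S = setT -> exists w, word_for S g w.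
Proof.
move=> gS; have: generated S g by rewrite gS.
suff: generated S `<=` [set g | exists w, word_for S g w] by apply.
apply: generated_subset => [|s Ss]; last first.
  exists [:: s]; split=> [a|]; last by rewrite big_seq1.
  by rewrite inE => /eqP ->; left.
split=> [|x y [v Sv] [w Sw]]; first by exists [::]; split=> //; rewrite big_nil.
exists (v ++ rev [seq x^-1 | x <- w]).
by apply: word_for_mul => //; apply: word_for_inv.
Qed.

Variable R : realType.

Lemma word_norm_le S g w : word_for S g w ->
  (word_norm R S g <= ((size w)%:R)%:E)%E.
Proof. by move=> Sw; apply: ereal_inf_lbound; exists w. Qed.

(** Word lengths are natural numbers, so the infimum in the word norm is a
    minimum. *)
Lemma word_norm_attained S g (r : R) : (word_norm R S g <= r%:E)%E ->
  exists2 w, word_for S g w & ((size w)%:R <= r)%R.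
Proof.
move=> ler; pose p n := `[< exists2 w, word_for S g w & size w = n >].
have exp : exists n, p n.
  apply: contrapT => nop; move: ler; rewrite leNgt => /negP; apply.
  apply: (@lt_le_trans _ _ +oo%E); first exact: ltey.
  apply: le_ereal_inf_tmp => x [w Sw _]; case: nop.
  by exists (size w); apply/asboolP; exists w.
case: (ex_minnP exp) => n /asboolP[w Sw <-] minw; exists w => //.
rewrite -lee_fin; apply: le_trans ler.
apply: le_ereal_inf_tmp => _ [v Sv <-]; rewrite lee_fin ler_nat.
by apply: minw; apply/asboolP; exists v.
Qed.

Lemma word_norm_gt0 S g : (0 < word_norm R S g)%E <-> g <> 1.
Proof.
split=> [gt0 g1|g1].
  have Sg : word_for S g [::] by split=> //; rewrite big_nil.
  by have := word_norm_le Sg; rewrite leNgt gt0.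
rewrite ltNge; apply/negP => /word_norm_attained[w [_ gw]].
rewrite -[0%R]/(0%:R)%R ler_nat leqn0 => /nilP w0.
by apply: g1; rewrite gw w0 big_nil.
Qed.

End WordNorm.

Section Distortion.
Variables (G1 G2 : groupType) (H : set G1) (f : G1 -> G2).
Variables (S1 : set G1) (S2 : set G2).
Hypothesis sH : subgroup H.
Hypothesis fM : forall x y, H x -> H y -> f (x * y) = f x * f y.

Lemma partial_morph1 : f 1 = 1.
Proof. by apply: (mulIg (f 1)); rewrite -fM ?mulg1 ?mul1g //; apply: sH.1. Qed.

Lemma partial_morphV x : H x -> f x^-1 = (f x)^-1.
Proof.
move=> Hx; have Hx' := subgroupV sH Hx.
by apply: (mulIg (f x)); rewrite -fM // !mulVg partial_morph1.
Qed.

(** The rewriting process of Reidemeister and Schreier: reading a word from the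
    right while keeping track of the coset representative [r], each letter [a]
    contributes one of the finitely many elements [r'^-1 * (a * r)] of [H]. The
    representative left over at the end accounts for the successor. *)
Lemma partial_morph_lipschitz s : covered_by_cosets H s ->
    finite_set S1 -> generated S2 = setT ->
  exists L : nat, forall h w, H h -> word_for S1 h w ->
    exists2 v, word_for S2 (f h) v & (size v <= L * (size w).+1)%N.
Proof.
move=> Hs /finite_seqP[t S1t] gS2.
pose wd g := projT1 (cid (word_for_exists g gS2)).
have wdP g : word_for S2 g (wd g) by rewrite /wd; case: cid.
pose A := t ++ [seq x^-1 | x <- t].
pose Y := (1 :: s) ++
  [seq r'^-1 * b | r' <- s, b <- [seq a * r | a <- A, r <- 1 :: s]].
pose L := \max_(y <- Y) size (wd (f y)).
have LP y : y \in Y -> (size (wd (f y)) <= L)%N.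
  by move=> yY; apply: (leq_bigmax_seq y).
have step h w : word_for S1 h w -> exists r y,
    [/\ r \in 1 :: s, H y, h = r * y &
    exists2 v, word_for S2 (f y) v & (size v <= L * size w)%N].
  elim: w h => [|a w IH] h [Sw ->].
    rewrite big_nil; exists 1, 1; rewrite mem_head mulg1.
    split=> //; first exact: sH.1.
    by exists [::] => //; split=> //; rewrite big_nil partial_morph1.
  have [|r [y [rs Hy hry [v Sv sv]]]] := IH (\prod_(s <- w) s).
    by split=> // b bw; apply: Sw; rewrite inE bw orbT.
  have [r' rs' Hr'] := Hs (a * r).
  exists r', (r'^-1 * (a * r) * y); split.
  - by rewrite inE rs' orbT.
  - exact: subgroupM.
  - by rewrite big_cons hry !mulgA mulgV mul1g.
  rewrite fM //; exists (wd (f (r'^-1 * (a * r))) ++ v).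
    exact: word_for_mul.
  rewrite size_cat /= mulnS leq_add //; apply: LP.
  rewrite mem_cat; apply/orP; right; apply/allpairsP.
  exists (r', a * r); split=> //; rewrite [snd _]/=.
  apply/allpairsP; exists (a, r); split=> //; rewrite [fst _]/=.
  rewrite mem_cat; have [|Sa|Sa] := Sw a; first by rewrite mem_head.
    by rewrite (_ : a \in t) //; move: Sa; rewrite S1t.
  apply/orP; right; rewrite -[a]invgK; apply: map_f.
  by move: Sa; rewrite S1t.
exists L => h w Hh /step[r [y [rs Hy hry [v Sv sv]]]].
have Hr : H r by rewrite -(mulgK y r) -hry; apply: sH.2.
exists (wd (f r) ++ v); first by rewrite hry fM //; apply: word_for_mul.
rewrite size_cat mulnS leq_add //; apply: LP.
by rewrite mem_cat rs.
Qed.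

End Distortion.

(** * Comparison of the growth functions *)

Section Comparison.
Variables (R : realType) (G1 G2 : groupType) (H : set G1) (f : G1 -> G2).
Hypothesis sH : subgroup H.
Hypothesis fM : forall x y, H x -> H y -> f (x * y) = f x * f y.
Local Open Scope ereal_scope.

Lemma divisibility_ge1 (G : groupType) (g : G) : 1 <= divisibility R g.
Proof.
apply: le_ereal_inf_tmp => _ [N [[sN _] _] <-]; exact: subgroup_index_ge1.
Qed.

(** Write [g = x * h] with [x] one of the representatives of the cosets of [H];
    the coset of [g] modulo [M] is determined by [x] and by the coset of [f h]
    modulo [N]. *)
Lemma subgroup_index_preimage_le s (N : set G2) (M : set G1) :
    covered_by_cosets H s -> subgroup N -> subgroup M ->
    (forall x, H x -> N (f x) -> M x) ->
  subgroup_index R M <= ((size s)%:R)%:E * subgroup_index R N.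
Proof.
move=> Hs sN sM HNM.
have s0 : (0 < size s)%N by have [r rs _] := Hs 1%g; case: s rs {Hs}.
have [->|[t Nt ->]] := subgroup_index_covered R sN.
  by rewrite gt0_muley ?leey // lte_fin ltr0n.
pose lift r := xget 1%g [set h | H h /\ N (r^-1 * f h)%g].
rewrite -EFinM -natrM -(size_allpairs (fun x r => x * lift r)%g s t).
apply: subgroup_index_le => // g.
have [x xs Hx] := Hs g; set h := (x^-1 * g)%g in Hx.
have [r rt Nr] := Nt (f h).
have [Hl Nl] : [set h | H h /\ N (r^-1 * f h)%g] (lift r).
  by apply: (@xgetI _ _ [set h | H h /\ N (r^-1 * f h)%g] h).
exists (x * lift r)%g; first by apply/allpairsP; exists (x, r).
have -> : ((x * lift r)^-1 * g = (lift r)^-1 * h)%g by rewrite invgM -mulgA.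
have Hl' := subgroupV sH Hl.
apply: HNM; first exact: subgroupM.
rewrite fM // (partial_morphV sH fM) //.
have -> : ((f (lift r))^-1 * f h = (r^-1 * f (lift r))^-1 * (r^-1 * f h))%g.
  by rewrite invgM invgK -mulgA mulVKg.
by apply: subgroupM => //; apply: subgroupV.
Qed.

(** If [N] separates [f (g ^+ e)] from 1, the normal closure of its preimage in
    [H] does not contain [g], as otherwise [g ^+ e] would be in that
    preimage. *)
Lemma divisibility_expg_le s : nilpotent_group G1 -> covered_by_cosets H s ->
  exists2 e, (0 < e)%N & forall g, H (g ^+ e)%g /\
    divisibility R g <= ((size s)%:R)%:E * divisibility R (f (g ^+ e)%g).
Proof.
move=> nil1 Hs; pose k := (size s)`!.
have Hk g : H (g ^+ k)%g by apply: covered_expg.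
have k0 : (0 < k)%N by apply: fact_gt0.
have s0 : (0 < size s)%N by have [r rs _] := Hs 1%g; case: s rs {Hs k Hk k0}.
have [m m0 rootm] := normal_closure_root nil1 k0.
exists (m * k)%N; first by rewrite muln_gt0 m0.
move=> g; rewrite expgnA; split=> //.
rewrite -lee_pdivrMl ?ltr0n //; apply: le_ereal_inf_tmp => _ [N [nN Ng] <-].
rewrite lee_pdivrMl ?ltr0n //.
have [sN _] := nN; pose N1 := [set x | H x /\ N (f x)].
have sN1 : subgroup N1.
  split=> [|x y [Hx Nx] [Hy Ny]].
    split; first exact: sH.1.
    by rewrite (partial_morph1 sH fM); apply: subgroup1.
  have Hy' := subgroupV sH Hy; split; first exact: sH.2.
  by rewrite fM // (partial_morphV sH fM) //; apply: sN.2.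
(* [h ^+ k] is in [H], which normalises [N1]. *)
have N1k y h : N1 y -> N1 [~ y, h ^+ k]%g.
  move=> [Hy Ny]; move: (h ^+ k)%g (Hk h) => {}h Hh.
  have [Hy' Hh'] := (subgroupV sH Hy, subgroupV sH Hh).
  have Hyh : H (y * h)%g by apply: subgroupM.
  have HJ : H (y ^ h)%g by apply: subgroupM.
  split; first exact: subgroupM.
  rewrite commgEl fM // fM // fM // !(partial_morphV sH fM) //.
  exact: normal_subgroupR.
have Mroot := rootm N1 sN1 N1k.
apply: (@le_trans _ _ (subgroup_index R (normal_closure N1))).
  apply: ereal_inf_lbound; exists (normal_closure N1) => //.
  split; first exact: normal_normal_closure.
  move=> /Mroot N1g; apply: Ng.
  by have [] : N1 ((g ^+ m) ^+ k)%g by apply: subgroupX.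
apply: subgroup_index_preimage_le => //.
  exact: (normal_normal_closure _).1.
by move=> x Hx Nx; apply: subset_normal_closure.
Qed.

Variables (S1 : set G1) (S2 : set G2).

Lemma rf_growth_ge1 (G : groupType) (S : set G) (r : R) : 1 <= rf_growth S r.
Proof.
rewrite /rf_growth; set D := [set _ | _ in _]; case: asboolP => // D0.
have /set0P[_ [g Sg _]] : D != set0 by apply/eqP.
apply: (le_trans (divisibility_ge1 g)).
by apply: ereal_sup_ubound; exists g.
Qed.

Lemma divisibility_le_rf_growth (G : groupType) (S : set G) g w (r : R) :
  word_for S g w -> g <> 1%g -> ((size w)%:R <= r)%R ->
  divisibility R g <= rf_growth S r.
Proof.
move=> Sw g1 wr; rewrite /rf_growth; set D := [set _ | _ in _].
have Dg : D (divisibility R g).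
  exists g => //; split; first exact/word_norm_gt0.
  by apply: (le_trans (word_norm_le R Sw)); rewrite lee_fin.
case: asboolP => [D0|_]; first by rewrite D0 in Dg.
exact: ereal_sup_ubound.
Qed.

Lemma rf_growth_le (G : groupType) (S : set G) (r : R) M :
  1 <= M -> (forall g w, g <> 1%g -> word_for S g w -> ((size w)%:R <= r)%R ->
     divisibility R g <= M) ->
  rf_growth S r <= M.
Proof.
move=> M1 DM; rewrite /rf_growth; case: asboolP => // _.
apply: ge_ereal_sup => _ [g [/word_norm_gt0 g1 leg] <-].
have [w Sw wr] := word_norm_attained leg.
exact: DM wr.
Qed.

(** Elements with [g ^+ e = 1] are bounded through torsion_separated, the others
    through divisibility_expg_le and the distortion bound. *)
Lemma growth_le_finite_index : finite_generating_set S1 ->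
    finite_generating_set S2 -> nilpotent_group G1 -> finite_index H ->
    (forall x, H x -> f x = 1%g -> x = 1%g) ->
  growth_le (@rf_growth R G1 S1) (@rf_growth R G2 S2).
Proof.
move=> fg1 [_ gS2] nil1 finH finj.
have [s Hs] := finite_index_covered sH finH.
have [e e0 div_le] := divisibility_expg_le nil1 Hs.
have [M [t [nM Mt torsM]]] := torsion_separated nil1 fg1 e0.
have [L lipL] := partial_morph_lipschitz sH fM Hs fg1.1 gS2.
pose C := (size s + size t + L * (e + 1) + 1)%N.
have C1 : (1 <= C)%N by rewrite /C addn1.
have CR : (0 < C%:R :> R)%R by rewrite ltr0n.
have leC n : (n <= C)%N -> (n%:R)%:E <= (C%:R : R)%:E.
  by move=> le; rewrite lee_fin ler_nat.
exists C%:R%R => // r _; have rf1 := rf_growth_ge1 S2 (C%:R * r)%R.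
have rf0 : 0 <= rf_growth S2 (C%:R * r)%R by apply: le_trans rf1.
have CleRF : (C%:R)%:E <= (C%:R)%:E * rf_growth S2 (C%:R * r)%R.
  rewrite -{1}[(C%:R)%:E]mule1.
  by apply: lee_wpmul2l => //; rewrite lee_fin ler0n.
apply: rf_growth_le => [|g w g1 Sw wr].
  by apply: le_trans CleRF; apply: (leC 1%N).
have [ge1|ge1] := pselect (g ^+ e = 1)%g.
  apply: le_trans CleRF; apply: (@le_trans _ _ (size t)%:R%:E); last first.
    by apply: leC; rewrite /C; lia.
  apply: le_trans (subgroup_index_le R nM.1 Mt).
  apply: ereal_inf_lbound; exists M => //; split=> // Mg.
  by apply: g1; apply: torsM.
have [He le_div] := div_le g; apply: (le_trans le_div).
have [v Sv sv] := word_for_expg e Sw.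
have [u S2u su] := lipL _ _ He Sv.
have f1 : f (g ^+ e)%g <> 1%g by move=> /(finj _ He).
have w0 : (0 < size w)%N.
  by case: w Sw {wr sv} => // -[_]; rewrite big_nil => /g1.
have le_u : (size u <= C * size w)%N.
  apply: (leq_trans su); rewrite sv.
  apply: (@leq_trans (L * (e + 1) * size w)); last first.
    by rewrite leq_mul // /C; lia.
  by rewrite -mulnA leq_mul2l mulnDl mul1n -addn1 leq_add2l w0 orbT.
have ur : ((size u)%:R <= C%:R * r)%R.
  apply: (@le_trans _ _ (C%:R * (size w)%:R)%R).
    by rewrite -natrM ler_nat.
  by rewrite ler_wpM2l // ler0n.
apply: (@le_trans _ _ ((size s)%:R%:E * rf_growth S2 (C%:R * r)%R)).
  rewrite lee_wpmul2l ?lee_fin ?ler0n //.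
  exact: divisibility_le_rf_growth S2u f1 ur.
by apply: lee_wpmul2r => //; apply: leC; rewrite /C; lia.
Qed.

End Comparison.

Theorem theorem3p6 (R : realType) (G1 G2 : groupType)
    (S1 : set G1) (S2 : set G2)
    (hS1 : finite_generating_set S1) (hS2 : finite_generating_set S2)
    (nil1 : nilpotent_group G1) (nil2 : nilpotent_group G2)
    (hcomm : commensurable G1 G2) :
  growth_equiv (@rf_growth R G1 S1) (@rf_growth R G2 S2).
Proof.
have [H1 [H2 [sH1 fin1 sH2 fin2 [f [[fH finj fsurj] fM]]]]] := hcomm.
have f1 : f 1 = 1 by apply: (partial_morph1 sH1 fM).
split.
  apply: (growth_le_finite_index _ sH1 fM) => // x Hx fx.
  by apply: finj; rewrite ?inE ?f1 //; apply: sH1.1.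
pose f' y := xget 1 [set x | H1 x /\ f x = y].
have f'P y : H2 y -> H1 (f' y) /\ f (f' y) = y.
  move=> /fsurj[x Hx fx].
  exact: (@xgetI _ 1 [set x | H1 x /\ f x = y] x).
apply: (@growth_le_finite_index R G2 G1 H2 f' sH2) => // [y z Hy Hz|y Hy f'y].
  have [Hfy fy] := f'P _ Hy; have [Hfz fz] := f'P _ Hz.
  have [Hfyz fyz] := f'P _ (subgroupM sH2 Hy Hz).
  apply: finj; rewrite ?inE //; first exact: subgroupM.
  by rewrite fM // fy fz fyz.
by have [_ <-] := f'P _ Hy; rewrite f'y.
Qed.
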